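(* Let $G$ be a finitely generated group and $\mu$ a non-degenerate aperiodic probability measure on $G$. The following properties are equivalent: (1) There exists a function $R(n)$, tending to infinity as $n\to\infty$, such that the distributions of the random walk $(G,\mu)$ are almost invariant on the scale $R(n)$. (2) There exists a sequence $R(n)$, tending to infinity on some subsequence, such that the distributions of the random walk $(G,\mu)$ are weakly individually almost invariant on the scale $R(n)$. (3) The Poisson boundary of $(G,\mu)$ is trivial.
   Context: $\mu^{*n}$ denotes the $n$-th convolution power, $S$ is a fixed finite generating set of $G$, and $l_{G,S}$ the word length. $\mu$ is non-degenerate if its support generates $G$ as a semigroup; it is aperiodic if the greatest common divisor of the $K\ge 1$ with $\mu^{*K}(e)>0$ is $1$. For $r:\mathbb{N}\to[0,\infty)$: the distributions of $(G,\mu)$ are almost invariant on the scale $r(n)$ if for every $\epsilon>0$ and all sufficiently large $n$ there is $V_{\epsilon,n}\subset G$ with $\mu^{*n}(V_{\epsilon,n})\ge 1-\epsilon$ such that for all $h\in V_{\epsilon,n}$ and all $g\in G$ with $l_{G,S}(g)\le r(n)$ one has $\mu^{*n}(h)>0$ and $|\mu^{*n}(hg)/\mu^{*n}(h)-1|\le\epsilon$. The distributions are weakly individually almost invariant on the scale $r(n)$ if for every sequence $g_n\in G$ with $l_{G,S}(g_n)\le r(n)$ there exist constants $a>0$ and $0<c\le C<\infty$ and subsets $V_n\subset G$ such that, for all sufficiently large $n$, $\mu^{*n}(V_n)>a$ and $c\le\mu^{*n}(hg_n)/\mu^{*n}(h)\le C$ for all $h\in V_n$ (with $\mu^{*n}(h)>0$).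 Triviality of the Poisson boundary means that every bounded function $f:G\to\mathbb{R}$ with $f(x)=\sum_{g\in G}\mu(g)f(gx)$ for all $x\in G$ is constant. *)

(* Defs.v *)
From HB Require Import structures.
From mathcomp Require Import all_boot all_order all_algebra.
From mathcomp Require Import all_classical all_reals all_analysis.

Set Implicit Arguments.
Unset Strict Implicit.
Unset Printing Implicit Defensive.

Import Order.TTheory GRing.Theory Num.Theory.
Import numFieldNormedType.Exports.

Local Open Scope classical_set_scope.
Local Open Scope ring_scope.

Section Words.
Variable G : groupType.
Implicit Types (A S : set G) (g : G) (n : nat).

Definition is_word A g n : Prop :=
  exists w : seq G,
    [/\ size w = n, (forall x, x \in w -> A x) & g = (\prod_(x <- w) x)%g].

Definition sym_set S : set G := [set x | S x \/ S (x^-1)%g].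

Definition generates_group S : Prop := forall g, exists n, is_word (sym_set S) g n.

(* Only nonempty products are allowed. *)
Definition generates_semigroup A : Prop :=
  forall g, exists2 n, (0 < n)%N & is_word A g n.

(* The junk value 0 is taken outside the subgroup generated by S. *)
Definition word_length S g : nat :=
  if pselect (exists n, `[< is_word (sym_set S) g n >]) is left ex
  then ex_minn ex else 0%N.

End Words.

Definition is_gcd (K : set nat) (d : nat) : Prop :=
  (forall k, K k -> (d %| k)%N) /\
  (forall e, (forall k, K k -> (e %| k)%N) -> (e %| d)%N).

Section RandomWalk.
Variables (R : realType) (G : groupType).
Implicit Types (mu nu f : G -> R) (r : nat -> R) (S V : set G).

(* Measures on the countable group G are given by their values on points. *)
Definition prob_measure mu : Prop :=
  (forall g, 0 <= mu g) /\ (\esum_(g in [set: G]) (mu g)%:E = 1)%E.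

Definition total_mass mu V : \bar R := \esum_(g in V) (mu g)%:E.

(* For probability measures the sum is at most 1, so that fine is harmless. *)
Definition convolution mu nu : G -> R :=
  fun x => fine (\esum_(g in [set: G]) (mu g * nu (g^-1 * x)%g)%:E).

Fixpoint convolution_power mu (n : nat) : G -> R :=
  if n is m.+1 then convolution mu (convolution_power mu m) else fun x => (x == 1%g)%:R.

Definition nondegenerate_walk mu : Prop := generates_semigroup [set g | 0 < mu g].

Definition aperiodic_walk mu : Prop :=
  is_gcd [set K | (1 <= K)%N /\ 0 < convolution_power mu K 1%g] 1%N.

Definition almost_invariant mu S r : Prop :=
  forall eps : R, 0 < eps ->
  \forall n \near \oo, exists V : set G,
    ((1 - eps)%:E <= total_mass (convolution_power mu n) V)%E /\
    forall h g, V h -> (word_length S g)%:R <= r n ->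
      0 < convolution_power mu n h /\
      `|convolution_power mu n (h * g)%g / convolution_power mu n h - 1| <= eps.

Definition weakly_individually_almost_invariant mu S r : Prop :=
  forall g : nat -> G, (forall n, (word_length S (g n))%:R <= r n) ->
  exists (a c C : R) (V : nat -> set G),
    [/\ 0 < a, 0 < c, c <= C &
      \forall n \near \oo,
        (a%:E < total_mass (convolution_power mu n) (V n))%E /\
        forall h, V n h -> 0 < convolution_power mu n h ->
          c <= convolution_power mu n (h * g n)%g / convolution_power mu n h <= C].

(* The sum of mu(g) f(gx) over g is absolutely convergent for bounded f; esum
   is only meant for nonnegative families, hence the two parts. *)
Definition mu_harmonic mu f : Prop :=
  forall x, let u := fun g : G => (mu g * f (g * x)%g)%:E in
    ((f x)%:E = \esum_(g in [set: G]) (u^\+ g)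
              - \esum_(g in [set: G]) (u^\- g))%E.

Definition trivial_Poisson_boundary mu : Prop :=
  forall f, (exists M : R, forall x, `|f x| <= M) -> mu_harmonic mu f ->
    exists k : R, forall x, f x = k.

End RandomWalk.

(* Main.v *)
Require Import Defs.
From HB Require Import structures.
From mathcomp Require Import all_boot all_order all_algebra.
From mathcomp Require Import all_classical all_reals all_analysis.
From mathcomp Require Import lra.

Set Implicit Arguments.
Unset Strict Implicit.
Unset Printing Implicit Defensive.

Import Order.TTheory GRing.Theory Num.Theory.
Import numFieldNormedType.Exports.

Local Open Scope classical_set_scope.
Local Open Scope ring_scope.

(** Write mu_n for the n-th convolution power. Iterating harmonicity gives
    f(x) = sum_h mu_n(h) f(hx), so values of bounded harmonic functions compare
    the measures mu_n with their right translates.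

    The first property, read along a sequence g_n, gives the second. The second
    property forces a trivial boundary. A nonconstant bounded harmonic function
    can be normalized to F with values in [0, 1] that comes within 1/k of 1 at
    some x and of 0 at some y. For g = x y^-1, if mu_n(hg) is at least
    c mu_n(h) on a set V of mu_n-mass a, then reindexing the sum for F(y) gives
    F(y) >= c * (sum over h in V of mu_n(h) F(hx)) >= c (a - 1/k),
    which is absurd for large k. As R is unbounded, a single sequence g_n with
    l(g_n) <= R(n) runs through such elements for arbitrarily large k
    ([weakly_invariant_trivial]).

    The main implication is from a trivial boundary to the first property. By
    Markov's inequality it suffices that for every x and every choice of test
    functions f_n : G -> [0, 1] the difference
    sum_h mu_n(h) f_n(hx) - sum_h mu_n(h) f_n(h) tends to 0; applied to the
    indicators of the sets where the ratio mu_n(hg)/mu_n(h) is too large or too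
    small, this bounds their masses. To prove it
    ([convolution_power_translate_cvg]), take limits along an ultrafilter:
    u_j(x) = lim_n sum_h mu_(n-j)(h) f_n(hx) satisfies
    u_j(x) = sum_g mu(g) u_(j+1)(gx), so u is a bounded space-time harmonic
    function. If mu_K(e) > 0 then u_(j+K) = u_j: near the supremum s > 0 of
    u_j - u_(j+K), the atom at e forces the m differences
    u_(j+iK)(x) - u_(j+(i+1)K)(x) to exceed s/2 as well, and they telescope to
    at most 1, a contradiction for large m
    ([space_time_harmonic_le_return]). Hence the periods of u have gcd 1 by
    aperiodicity, u does not depend on j, u_0 is bounded harmonic, therefore
    constant, and the limit of the difference is u_0(x) - u_0(e) = 0. As balls
    are finite, a diagonal choice of the radius gives the function R. *)

(** * Expectations under a probability measure on a group *)

Lemma esumZ (R : realType) (T : choiceType) (c : R) (a : T -> \bar R) :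
  0 <= c -> (forall i, 0 <= a i)%E ->
  (\esum_(i in [set: T]) (c%:E * a i) = c%:E * \esum_(i in [set: T]) a i)%E.
Proof.
move=> c0 a0; rewrite /esum -ereal_supZl//; last first.
  by apply/set0P; exists (\sum_(i \in set0) a i)%E, set0 => //; exact: fsets_set0.
congr ereal_sup; apply/seteqP; split=> [_ [A Afin <-]|_ [_ [A Afin <-] <-]].
  by exists (\sum_(i \in A) a i)%E; [exists A|rewrite ge0_mule_fsumr].
by exists A => //; rewrite ge0_mule_fsumr.
Qed.

Lemma esum_swap (R : realType) (T : choiceType) (a : T -> T -> \bar R) :
  (forall i j, 0 <= a i j)%E ->
  (\esum_(i in [set: T]) \esum_(j in [set: T]) a i j =
   \esum_(j in [set: T]) \esum_(i in [set: T]) a i j)%E.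
Proof.
move=> a0; rewrite !esum_esum//.
rewrite (@reindex_esum _ _ _ ([set: T] `*`` (fun=> setT)) _ (fun k => (k.2, k.1)))//.
split=> //=.
- by move=> [i j] [i' j'] _ _ [-> ->].
- by move=> [i j] _; exists (j, i).
Qed.

Section Expectation.
Variables (R : realType) (G : groupType).
Implicit Types (p q f : G -> R) (V : set G).

(** For p the point masses of a probability measure and f nonnegative and
    bounded, the expectation of f under p. Signed functions are avoided by
    shifting, which keeps every sum a sum of nonnegative terms. *)
Definition Ex p f : R := fine (\esum_(g in [set: G]) (p g * f g)%:E).

Definition nnbounded f := exists M, forall x, 0 <= f x <= M.

Lemma nnboundedD f1 f2 : nnbounded f1 -> nnbounded f2 ->
  nnbounded (fun x => f1 x + f2 x).
Proof.
move=> [M bM] [N bN]; exists (M + N) => x.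
by have /andP[? ?] := bM x; have /andP[? ?] := bN x; rewrite addr_ge0 ?lerD.
Qed.

Lemma nnboundedZ c f : 0 <= c -> nnbounded f -> nnbounded (fun x => c * f x).
Proof.
move=> c0 [M bM]; exists (c * M) => x.
by have /andP[? ?] := bM x; rewrite mulr_ge0 ?ler_wpM2l.
Qed.

Lemma nnbounded_cst c : 0 <= c -> nnbounded (fun=> c).
Proof. by move=> c0; exists c => x; rewrite c0 lexx. Qed.

Lemma nnbounded01 f : (forall x, 0 <= f x <= 1) -> nnbounded f.
Proof. by exists 1. Qed.

Lemma nnbounded_comp f (s : G -> G) : nnbounded f -> nnbounded (fun x => f (s x)).
Proof. by move=> [M bM]; exists M => x. Qed.

Lemma indic01 V x : 0 <= (\1_V x : R) <= 1.
Proof. by rewrite indicE; case: (x \in V); rewrite ?lexx ?ler01. Qed.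

Lemma nnbounded_indic V : nnbounded (\1_V : G -> R).
Proof. by apply: nnbounded01; exact: indic01. Qed.

Lemma prob_le1 p x : prob_measure p -> 0 <= p x <= 1.
Proof.
move=> [p0 p1]; rewrite p0 /= -lee_fin -p1.
rewrite (esumID [set x]); last by move=> i _; rewrite lee_fin.
rewrite setTI esum_set1 ?lee_fin// leeDl// esum_ge0// => i _.
by rewrite lee_fin.
Qed.

Lemma nnbounded_prob p : prob_measure p -> nnbounded p.
Proof. by move=> pp; apply: nnbounded01 => x; exact: prob_le1. Qed.

Variable p : G -> R.
Hypothesis pp : prob_measure p.

Let p0 g : 0 <= p g. Proof. by case: pp. Qed.

Lemma ExE f : nnbounded f ->
  (Ex p f)%:E = (\esum_(g in [set: G]) (p g * f g)%:E)%E.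
Proof.
move=> [M bM]; rewrite /Ex fineK// ge0_fin_numE; last first.
  by apply: esum_ge0 => g _; rewrite lee_fin mulr_ge0//; have /andP[] := bM g.
have M0 : 0 <= M by have /andP[] := bM 1%g; exact: le_trans.
apply: (@le_lt_trans _ _ (\esum_(g in [set: G]) (M%:E * (p g)%:E))%E).
  apply: le_esum => g _; rewrite -EFinM lee_fin mulrC ler_wpM2r//.
  by have /andP[] := bM g.
by rewrite esumZ// (proj2 pp) mule1 ltry.
Qed.

Lemma Ex_ge0 f : nnbounded f -> 0 <= Ex p f.
Proof.
move=> [M bM]; rewrite /Ex fine_ge0// esum_ge0// => g _.
by rewrite lee_fin mulr_ge0//; have /andP[] := bM g.
Qed.

Lemma eq_Ex f1 f2 : f1 =1 f2 -> Ex p f1 = Ex p f2.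
Proof. by move=> /funext ->. Qed.

(** Points of mass zero are exempted because a ratio of masses only makes
    sense on the support. *)
Lemma Ex_le f1 f2 : nnbounded f1 -> nnbounded f2 ->
  (forall g, 0 < p g -> f1 g <= f2 g) -> Ex p f1 <= Ex p f2.
Proof.
move=> b1 b2 le12; rewrite -lee_fin !ExE//; apply: le_esum => g _.
rewrite lee_fin; have := p0 g; rewrite le_eqVlt => /predU1P[<-|pg].
  by rewrite !mul0r.
by rewrite ler_wpM2l ?le12// ltW.
Qed.

Lemma prob_shift k : prob_measure (fun h => p (h * k)%g).
Proof.
split=> [h|]; first exact: p0.
rewrite -[RHS](proj2 pp).
rewrite [RHS](@reindex_esum _ _ _ setT setT (fun h => h * k)%g)//.
split=> //=; first by move=> g h _ _ /mulIg.
by move=> g _; exists (g * k^-1)%g; rewrite ?mulgVK.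
Qed.

Lemma ExD f1 f2 : nnbounded f1 -> nnbounded f2 ->
  Ex p (fun g => f1 g + f2 g) = Ex p f1 + Ex p f2.
Proof.
move=> b1 b2; apply: EFin_inj; rewrite EFinD !ExE//; last exact: nnboundedD.
rewrite -esumD.
- by apply: eq_esum => g _; rewrite mulrDr EFinD.
- by case: b1 => M bM g _; rewrite lee_fin mulr_ge0//; have /andP[] := bM g.
- by case: b2 => M bM g _; rewrite lee_fin mulr_ge0//; have /andP[] := bM g.
Qed.

Lemma ExZ c f : 0 <= c -> nnbounded f -> Ex p (fun g => c * f g) = c * Ex p f.
Proof.
move=> c0 b; apply: EFin_inj; rewrite EFinM !ExE//; last exact: nnboundedZ.
rewrite -esumZ//; first by apply: eq_esum => g _; rewrite -EFinM mulrCA.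
by case: b => M bM g; rewrite lee_fin mulr_ge0//; have /andP[] := bM g.
Qed.

Lemma Ex_cst c : 0 <= c -> Ex p (fun=> c) = c.
Proof.
move=> c0; have b1 : nnbounded (fun=> 1 : R) by exact: nnbounded_cst.
have -> : (fun=> c) = (fun g : G => c * 1) by apply/funext => g; rewrite mulr1.
rewrite ExZ// [X in c * X](_ : _ = 1) ?mulr1//.
apply: EFin_inj; rewrite ExE// -(proj2 pp).
by apply: eq_esum => g _; rewrite mulr1.
Qed.

Lemma Ex01 f : (forall x, 0 <= f x <= 1) -> 0 <= Ex p f <= 1.
Proof.
move=> f01; have b := nnbounded01 f01.
rewrite Ex_ge0//= -[leRHS](@Ex_cst 1)// Ex_le//; first exact: nnbounded_cst.
by move=> g _; have /andP[] := f01 g.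
Qed.

Lemma Ex_compl f : (forall x, 0 <= f x <= 1) ->
  Ex p (fun x => 1 - f x) = 1 - Ex p f.
Proof.
move=> f01; have b := nnbounded01 f01.
have b' : nnbounded (fun x => 1 - f x).
  by apply: nnbounded01 => x; have := f01 x; lra.
suff : Ex p (fun x => 1 - f x) + Ex p f = 1 by lra.
rewrite -ExD// -[RHS](@Ex_cst 1)//; apply: eq_Ex => x; lra.
Qed.

Lemma total_massE V : total_mass p V = (Ex p \1_V)%:E.
Proof.
rewrite ExE; last exact: nnbounded_indic.
rewrite /total_mass esum_mkcond; apply: eq_esum => g _.
by rewrite indicE; case: (g \in V); rewrite ?mulr1 ?mulr0.
Qed.

Lemma Ex_indic1 a : Ex p \1_[set a] = p a.
Proof.
by apply: EFin_inj; rewrite -total_massE /total_mass esum_set1// lee_fin.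
Qed.

Lemma Ex_shift f k : Ex p (fun h => f (h * k)%g) = Ex (fun h => p (h * k^-1)%g) f.
Proof.
rewrite /Ex; congr fine.
rewrite [RHS](@reindex_esum _ _ _ setT setT (fun h => h * k)%g)//.
  by apply: eq_esum => h _; rewrite mulgK.
split=> //=; first by move=> g h _ _ /mulIg.
by move=> g _; exists (g * k^-1)%g; rewrite ?mulgVK.
Qed.

(** The substitute for dominated convergence: all but eps of the mass lives on
    a finite set, on which pointwise limits are uniform. *)
Lemma Ex_tight eps : 0 < eps ->
  exists2 A : set G, finite_set A & Ex p \1_(~` A) <= eps.
Proof.
move=> e0.
have : ((1 - eps)%:E < total_mass p setT)%E.
  by rewrite /total_mass (proj2 pp) lte_fin; lra.
move=> /ereal_sup_gt[_ [A [finA _] <-]] ltA; exists A => //.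
have : ((1 - eps)%:E <= total_mass p A)%E.
  apply: le_trans (ltW ltA) _; apply: esum_ge; exists A => //.
  by split.
rewrite total_massE lee_fin.
have -> : \1_(~` A) = (fun x => 1 - \1_A x) :> (G -> R).
  apply/funext => x; rewrite !indicE in_setC; case: (x \in A) => /=; lra.
rewrite Ex_compl; last exact: indic01.
lra.
Qed.

End Expectation.

(** * Convolution powers *)

Section Convolution.
Variables (R : realType) (G : groupType).
Implicit Types (p q f mu : G -> R) (V : set G).

(** Comparing two measures only on the support of the integrand is what lets a
    bound on the ratio of masses over a set V be integrated over V. *)
Lemma Ex_le_weight p q f a b : prob_measure p -> prob_measure q -> nnbounded f ->
  0 <= a -> 0 <= b -> (forall h, f h != 0 -> a * p h <= b * q h) ->
  a * Ex p f <= b * Ex q f.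
Proof.
move=> pp pq bf a0 b0 le_ab; have p0 := proj1 pp; have [M bM] := bf; have q0 := proj1 pq.
have f0 h : 0 <= f h by have /andP[] := bM h.
rewrite -lee_fin !EFinM !ExE// -!esumZ//; last 2 first.
  by move=> h; rewrite lee_fin mulr_ge0.
  by move=> h; rewrite lee_fin mulr_ge0.
apply: le_esum => h _; rewrite -!EFinM lee_fin !mulrA.
have [->|fh] := eqVneq (f h) 0; first by rewrite !mulr0.
by rewrite ler_wpM2r// le_ab.
Qed.

Lemma Ex_swap p q (F : G -> G -> R) : prob_measure p -> prob_measure q ->
  (exists M, forall g h, 0 <= F g h <= M) ->
  Ex p (fun g => Ex q (F g)) = Ex q (fun h => Ex p (F^~ h)).
Proof.
move=> pp pq [M bM].
have M0 : 0 <= M by have /andP[] := bM 1%g 1%g; exact: le_trans.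
have bF g : nnbounded (F g) by exists M.
have bF' h : nnbounded (F^~ h) by exists M.
have bEx r (H : G -> R) : prob_measure r -> (forall g, 0 <= H g <= M) -> 0 <= Ex r H <= M.
  move=> pr bH; have nH : nnbounded H by exists M.
  rewrite Ex_ge0//= -(@Ex_cst _ _ r pr M M0) Ex_le//; first exact: nnbounded_cst.
  by move=> g _; have /andP[] := bH g.
apply: EFin_inj; rewrite !ExE//; last 2 first.
  by exists M => g; exact: bEx.
  by exists M => g; exact: bEx.
have p0 := proj1 pp; have q0 := proj1 pq.
have F0 g h : 0 <= F g h by have /andP[] := bM g h.
transitivity (\esum_(g in [set: G]) \esum_(h in [set: G]) (p g * (q h * F g h))%:E)%E.
  apply: eq_esum => g _; rewrite EFinM ExE// -esumZ//.
  by move=> h; rewrite lee_fin mulr_ge0.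
rewrite esum_swap; last by move=> g h; rewrite lee_fin !mulr_ge0.
apply: eq_esum => h _; rewrite EFinM ExE// -esumZ//; last first.
  by move=> g; rewrite lee_fin mulr_ge0.
by apply: eq_esum => g _; rewrite -EFinM mulrCA.
Qed.

Lemma nnbounded_Ex p (F : G -> G -> R) : prob_measure p ->
  (exists M, forall g h, 0 <= F g h <= M) -> nnbounded (fun g => Ex p (F g)).
Proof.
move=> pp [M bM].
have M0 : 0 <= M by have /andP[] := bM 1%g 1%g; exact: le_trans.
exists M => g; have bF : nnbounded (F g) by exists M.
rewrite Ex_ge0//= -(@Ex_cst _ _ p pp M M0) Ex_le//; first exact: nnbounded_cst.
by move=> h _; have /andP[] := bM g h.
Qed.

(** Fubini and the substitution x = gh. The left-hand side is kept extended so
    that the case f = 1 shows that convolutions have total mass 1. *)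
Lemma esum_convolution p q f : prob_measure p -> prob_measure q -> nnbounded f ->
  (\esum_(x in [set: G]) (convolution p q x * f x)%:E)%E =
  (Ex p (fun g => Ex q (fun h => f (g * h)%g)))%:E.
Proof.
move=> pp pq [M bM].
have p0 := proj1 pp; have q0 := proj1 pq.
have f0 x : 0 <= f x by have /andP[] := bM x.
have bq x : nnbounded (fun g => q (g^-1 * x)%g).
  by apply: (@nnbounded_comp _ _ q (fun g => g^-1 * x)%g); exact: nnbounded_prob.
transitivity (\esum_(x in [set: G]) \esum_(g in [set: G])
    (p g * (q (g^-1 * x)%g * f x))%:E)%E.
  apply: eq_esum => x _.
  rewrite mulrC EFinM -[convolution p q x]/(Ex p (fun g => q (g^-1 * x)%g)) ExE//.
  rewrite -esumZ//; last by move=> g; rewrite lee_fin mulr_ge0.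
  by apply: eq_esum => g _; rewrite -EFinM mulrCA [f x * _]mulrC.
rewrite esum_swap; last by move=> x g; rewrite lee_fin !mulr_ge0.
rewrite ExE//; last first.
  by apply: (@nnbounded_Ex _ (fun g h => f (g * h)%g)) => //; exists M.
apply: eq_esum => g _.
rewrite EFinM ExE//; last by exists M.
rewrite -esumZ//; last by move=> h; rewrite lee_fin mulr_ge0.
rewrite (@reindex_esum _ _ _ setT setT (fun h => g * h)%g)//.
  by apply: eq_esum => h _; rewrite mulKg.
split=> //=; first by move=> a b _ _ /mulgI.
by move=> a _; exists (g^-1 * a)%g; rewrite ?mulVKg.
Qed.

Lemma prob_convolution p q :
  prob_measure p -> prob_measure q -> prob_measure (convolution p q).
Proof.
move=> pp pq; have p0 := proj1 pp; have q0 := proj1 pq; split=> [x|].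
  apply: (Ex_ge0 pp (f := fun g => q (g^-1 * x)%g)).
  by apply: (@nnbounded_comp _ _ q (fun g => g^-1 * x)%g); exact: nnbounded_prob.
have := @esum_convolution p q (fun=> 1) pp pq (nnbounded_cst _ ler01).
rewrite !Ex_cst// => {1}<-.
by apply: eq_esum => x _; rewrite mulr1.
Qed.

Lemma Ex_convolution p q f : prob_measure p -> prob_measure q -> nnbounded f ->
  Ex (convolution p q) f = Ex p (fun g => Ex q (fun h => f (g * h)%g)).
Proof. by move=> pp pq bf; rewrite {1}/Ex esum_convolution. Qed.

Variable mu : G -> R.
Hypothesis prob_mu : prob_measure mu.
Local Notation p_ := (convolution_power mu).

Lemma prob_convolution_power n : prob_measure (p_ n).
Proof.
elim: n => [|n IHn]; last exact: prob_convolution.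
split=> [x /=|]; first by rewrite ler0n.
rewrite (esumID [set 1%g]); last by move=> i _; rewrite lee_fin ler0n.
rewrite setTI esum_set1 ?lee_fin ?ler0n//= eqxx esum1 ?adde0// => i [_ /eqP/negPf] /= ->.
by [].
Qed.

Local Hint Resolve prob_convolution_power : core.

Lemma Ex_power0 f : nnbounded f -> Ex (p_ 0) f = f 1%g.
Proof.
move=> bf; apply: EFin_inj; rewrite ExE//.
have f0 x : 0 <= f x by case: bf => M /(_ x) /andP[].
rewrite (esumID [set 1%g]); last first.
  by move=> i _ /=; rewrite lee_fin mulr_ge0// ler0n.
rewrite setTI esum_set1 /= ?eqxx ?mul1r ?lee_fin//.
rewrite esum1 ?adde0// => i [_ /eqP/negPf ->].
by rewrite mul0r.
Qed.

Lemma Ex_powerS n f : nnbounded f ->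
  Ex (p_ n.+1) f = Ex mu (fun g => Ex (p_ n) (fun h => f (g * h)%g)).
Proof. by move=> bf; rewrite [p_ n.+1]/= Ex_convolution. Qed.

(** Powers unfold by definition on the left, whereas the harmonicity equation
    f(x) = sum_g mu(g) f(gx) splits off the increment applied first, which is
    the rightmost factor of h * g; associativity, proved by induction on all f
    at once, allows both. *)
Lemma Ex_powerSr n f : nnbounded f ->
  Ex (p_ n.+1) f = Ex mu (fun g => Ex (p_ n) (fun h => f (h * g)%g)).
Proof.
move=> bf; have [M bM] := bf.
rewrite -[RHS](@Ex_swap _ _ (fun h g => f (h * g)%g))//; last by exists M.
elim: n f bf M bM => [|n IHn] f bf M bM.
  rewrite Ex_powerS// Ex_power0; last first.
    by apply: (@nnbounded_Ex _ (fun g h => f (g * h)%g)) => //; exists M.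
  apply: eq_Ex => g; rewrite Ex_power0 ?mulg1 ?mul1g//.
  exact: (@nnbounded_comp _ _ f (fun h => g * h)%g).
rewrite Ex_powerS// [in RHS]Ex_powerS; last first.
  by apply: (@nnbounded_Ex _ (fun g h => f (g * h)%g)) => //; exists M.
apply: eq_Ex => g; rewrite (IHn (fun h => f (g * h)%g) _ M)//; last by exists M.
by apply: eq_Ex => h; apply: eq_Ex => k; rewrite mulgA.
Qed.

End Convolution.


(** * Bounded space-time harmonic functions *)

Section SpaceTime.
Variables (R : realType) (G : groupType) (mu : G -> R).
Hypothesis prob_mu : prob_measure mu.
Local Notation p_ := (convolution_power mu).

Let prob_power n : prob_measure (p_ n).
Proof. exact: prob_convolution_power. Qed.
Local Hint Resolve prob_power : core.

Definition space_time_harmonic (u : nat -> G -> R) :=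
  forall j x, u j x = Ex mu (fun g => u j.+1 (g * x)%g).

Lemma space_time_harmonic_power u n j x : (forall i y, 0 <= u i y <= 1) ->
  space_time_harmonic u ->
  u j x = Ex (p_ n) (fun h => u (j + n)%N (h * x)%g).
Proof.
move=> u01 hu.
have bu i y : nnbounded (fun h => u i (h * y)%g) by apply: nnbounded01 => h; exact: u01.
elim: n j x => [|n IHn] j x; first by rewrite Ex_power0// addn0 mul1g.
rewrite Ex_powerSr// hu; apply: eq_Ex => g.
by rewrite IHn addSnnS; apply: eq_Ex => h; rewrite mulgA.
Qed.

Lemma space_time_harmonic_compl u : (forall i y, 0 <= u i y <= 1) ->
  space_time_harmonic u -> space_time_harmonic (fun j x => 1 - u j x).
Proof.
by move=> u01 hu j x; rewrite (Ex_compl prob_mu (f := fun g => u j.+1 (g * x)%g))// -hu.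
Qed.

(** A Choquet-Deny argument. With al the mass at e of the K-th power and s the
    supremum of v_i = u_i - u_(i+K), harmonicity gives
    al (s - v_(i+K)) <= s - v_i pointwise, so a point where v_i is close to s
    keeps v_(i+nK) close to s for n up to any fixed m. The values v_(i+nK) sum
    to a difference of two values of u, hence to at most 1, so s > 0 is
    impossible. *)
Lemma space_time_harmonic_le_return u K j x : (forall i y, 0 <= u i y <= 1) ->
  space_time_harmonic u -> 0 < p_ K 1%g -> u j x <= u (j + K)%N x.
Proof.
have /andP[_] : 0 <= p_ K 1%g <= 1 by exact: prob_le1.
set al := p_ K 1%g => al1 u01 hu al0.
pose v i y := u i y - u (i + K)%N y.
rewrite -subr_le0 -/(v j x) leNgt; apply/negP => vpos.
pose E := [set v iy.1 iy.2 | iy in [set: nat * G]].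
have ubE : has_ubound E.
  exists 1 => _ [[i y] _ <-] /=; rewrite /v.
  by have := u01 i y; have := u01 (i + K)%N y; lra.
have vs i y : v i y <= sup E by apply: ub_le_sup => //; exists (i, y).
have s0 : 0 < sup E by apply: lt_le_trans vpos _.
set s := sup E in vs s0.
have step i y : al * (s - v (i + K)%N y) <= s - v i y.
  rewrite {2}/v (space_time_harmonic_power K i y u01 hu).
  rewrite (space_time_harmonic_power K (i + K)%N y u01 hu).
  set F := fun h => u (i + K)%N (h * y)%g.
  set F' := fun h => u (i + K + K)%N (h * y)%g.
  have bF : nnbounded F by apply: nnbounded01 => h; exact: u01.
  have bF' : nnbounded F' by apply: nnbounded01 => h; exact: u01.
  have c0 : 0 <= s - v (i + K)%N y by rewrite subr_ge0.
  have b1 : nnbounded (\1_[set 1%g] : G -> R) by exact: nnbounded_indic.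
  have bs : nnbounded (fun _ : G => s) by exact/nnbounded_cst/ltW.
  (* v (i + K) is at most s everywhere, and at h = 1 its value is kept exactly. *)
  suff : Ex (p_ K) (fun h => F h + (s - v (i + K)%N y) * \1_[set 1%g] h) <=
         Ex (p_ K) (fun h => F' h + s).
    rewrite !ExD// ?ExZ// ?Ex_cst// ?Ex_indic1//; last 2 first.
      exact: ltW.
      exact: nnboundedZ.
    rewrite -/al; lra.
  have b2 := nnboundedZ c0 b1.
  apply: Ex_le => //; [exact: nnboundedD|exact: nnboundedD|move=> h _].
  rewrite indicE; case: (boolP (h \in _)) => [|_].
    by rewrite inE => ->; rewrite /F /F' /v mul1g mulr1; lra.
  by have := vs (i + K)%N (h * y)%g; rewrite /v -/(F h) -/(F' h) mulr0; lra.
have iter n i y : al ^+ n * (s - v (i + n * K)%N y) <= s - v i y.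
  elim: n i y => [|n IHn] i y; first by rewrite addn0 expr0 mul1r.
  apply: le_trans (step i y); rewrite exprS -mulrA ler_wpM2l ?(ltW al0)//.
  by rewrite mulSn addnA.
have [m mP] : exists m : nat, 1 < m%:R * (s / 2).
  have := archi_boundP (ltW (divr_gt0 ltr01 (divr_gt0 s0 (ltr0n R 2)))).
  set m := Num.bound _ => lem; exists m.
  by rewrite -ltr_pdivrMr ?divr_gt0.
(* The margin is scaled by al ^+ m to survive m divisions by al. *)
have [_ [[i y] _ <-] /=] : exists2 e, E e & s - (s / 2) * al ^+ m < e.
  apply: sup_adherent; first by rewrite mulr_gt0 ?divr_gt0 ?exprn_gt0.
  by split=> //; exists (v j x), (j, x).
move=> near_sup.
have vge n : (n <= m)%N -> s / 2 <= v (i + n * K)%N y.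
  move=> nm; have := iter n i y => ien.
  suff : s - v (i + n * K)%N y <= s / 2 by lra.
  rewrite -(ler_pM2l (exprn_gt0 n al0)); apply: le_trans ien _.
  apply: (@le_trans _ _ (s / 2 * al ^+ m)); first by lra.
  rewrite mulrC ler_wpM2r ?divr_ge0 ?(ltW s0)//.
  by apply: ler_wiXn2l => //; exact: ltW.
have tele n : (n <= m)%N -> n%:R * (s / 2) <= u i y - u (i + n * K)%N y.
  elim: n => [|n IHn] nm; first by rewrite mul0r addn0 subrr.
  have := IHn (ltnW nm); have := vge n (ltnW nm).
  by rewrite /v mulSn [(K + _)%N]addnC addnA -[n.+1%:R]natr1 mulrDl mul1r; lra.
have := tele m (leqnn m); have := u01 i y; have := u01 (i + m * K)%N y; lra.
Qed.

Lemma space_time_harmonic_return u K j x : (forall i y, 0 <= u i y <= 1) ->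
  space_time_harmonic u -> 0 < p_ K 1%g -> u j x = u (j + K)%N x.
Proof.
move=> u01 hu K0; apply/eqP; rewrite eq_le.
rewrite (space_time_harmonic_le_return _ _ u01 hu K0) /=.
have u01' i y : 0 <= 1 - u i y <= 1 by have := u01 i y; lra.
have := space_time_harmonic_le_return j x u01' (space_time_harmonic_compl u01 hu) K0.
lra.
Qed.

(** The periods of u contain all return times, and the least positive one
    divides the others since remainders are again periods; aperiodicity makes it
    equal to 1. *)
Lemma space_time_harmonic_aperiodic u j x : aperiodic_walk mu ->
  (forall i y, 0 <= u i y <= 1) -> space_time_harmonic u -> u j x = u j.+1 x.
Proof.
move=> ap u01 hu.
pose per d := forall i y, u i y = u (i + d)%N y.
have perM d n : per d -> per (n * d)%N.
  move=> pd i y; elim: n => [|n IHn]; first by rewrite addn0.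
  by rewrite mulSn [(d + _)%N]addnC addnA -pd.
have [d pd dP] : exists2 d, per d & forall K, per K -> (d %| K)%N.
  (* If 0 were the only period, it would still divide all of them. *)
  have [[d [d0 pd]]|npos] := pselect (exists d, (0 < d)%N /\ per d); last first.
    exists 0%N => [i y|K pK]; first by rewrite addn0.
    by case: K pK => // K pK; case: npos; exists K.+1.
  have ex : exists d, (0 < d)%N && `[< per d >] by exists d; rewrite d0; exact/asboolP.
  have [e /andP[e0 /asboolP pe] emin] := ex_minnP ex.
  exists e => // K pK; rewrite /dvdn eqn0Ngt; apply/negP => r0.
  suff /emin : (0 < K %% e)%N && `[< per (K %% e)%N >] by rewrite leqNgt ltn_pmod.
  rewrite r0; apply/asboolP => i y; rewrite pK {1}(divn_eq K e) addnC.
  by rewrite -addnA addnC [(_ + i)%N]addnC -perM.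
have : (d %| 1)%N.
  apply: (proj2 ap) => K [_ K0]; apply: dP => i y.
  exact: space_time_harmonic_return.
by rewrite dvdn1 => /eqP d1; rewrite pd d1 addn1.
Qed.

End SpaceTime.


(** * Limits along filters *)

Lemma near_finite (T I : Type) (F : set_system T) (A : set I) (Q : I -> T -> Prop) :
  Filter F -> finite_set A -> (forall i, A i -> \forall t \near F, Q i t) ->
  \forall t \near F, forall i, A i -> Q i t.
Proof.
move=> FF; elim/Pchoice: I => I in A Q *.
move=> /finite_seqP[s ->]; elim: s => [|i s IHs] FQ.
  by apply: nearW => t i; rewrite /= in_nil.
have := FQ i; rewrite /= inE eqxx => /(_ isT) Fi.
have Fs : \forall t \near F, forall j, [set` s] j -> Q j t.
  by apply: IHs => j js; apply: FQ; rewrite /= inE (js : j \in s) orbT.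
apply: filterS2 Fi Fs => t Qi Qs j /=; rewrite inE => /orP[/eqP ->//|]; exact: Qs.
Qed.

Lemma ultra_cvg01 (R : realType) (T : Type) (U : set_system T) (a : T -> R) :
  UltraFilter U -> (forall t, 0 <= a t <= 1) -> cvg (a t @[t --> U]).
Proof.
move=> UU a01.
have aU : (a t @[t --> U]) [set` `[0, 1]].
  by apply: (@filterE _ U) => t /=; rewrite in_itv /=; exact: a01.
have [l [_ cl]] := @segment_compact R 0 1 _ (fmap_proper_filter a _) aU.
apply/cvg_ex; exists l => N Nl.
have [//|UN] := in_ultra_setVsetC (a @^-1` N) UU.
by have [x []] := cl (~` N) N UN Nl.
Qed.

(** * Harmonic functions and translates of convolution powers *)

Section Limits.
Variables (R : realType) (G : groupType) (mu : G -> R).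
Hypothesis prob_mu : prob_measure mu.

Lemma cvg_Ex (T : Type) (U : set_system T) (F : T -> G -> R) (l : G -> R) :
  Filter U -> (forall t g, 0 <= F t g <= 1) -> (forall g, 0 <= l g <= 1) ->
  (forall g, F t g @[t --> U] --> l g) ->
  Ex mu (F t) @[t --> U] --> Ex mu l.
Proof.
move=> FU F01 l01 Fl; apply/cvgrPdist_le => eps eps0.
have e2 : 0 < eps / 2 by rewrite divr_gt0.
have [A finA tailA] := Ex_tight prob_mu e2.
have near_A : \forall t \near U, forall g, A g -> `|l g - F t g| <= eps / 2.
  by apply: near_finite => // g _; move/cvgrPdist_le: (Fl g); apply.
have Ex_near f1 f2 : (forall g, 0 <= f1 g <= 1) -> (forall g, 0 <= f2 g <= 1) ->
    (forall g, A g -> `|f1 g - f2 g| <= eps / 2) -> Ex mu f1 <= Ex mu f2 + eps.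
  move=> b1 b2 d12.
  have nb2 : nnbounded f2 by exact: nnbounded01.
  have nbe : nnbounded (fun _ : G => eps / 2) by exact/nnbounded_cst/ltW.
  have nbA : nnbounded (\1_(~` A) : G -> R) by exact: nnbounded_indic.
  apply: (@le_trans _ _ (Ex mu (fun g => f2 g + (eps / 2 + \1_(~` A) g)))).
    apply: Ex_le => //; [exact: nnbounded01| |move=> g _].
      by apply: nnboundedD => //; exact: nnboundedD.
    rewrite indicE in_setC; have [/set_mem/d12|_] := boolP (g \in A).
      by rewrite ler_distl => /andP[_]; rewrite /=; lra.
    by have := b1 g; have := b2 g; rewrite /=; lra.
  rewrite !ExD// ?Ex_cst//; [lra|exact: ltW|exact: nnboundedD].
apply: filterS near_A => t At; rewrite ler_distl; apply/andP; split.
  by rewrite lerBlDr; apply: Ex_near => // g Ag; rewrite distrC; exact: At.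
by apply: Ex_near.
Qed.

(** Bridges the extended-real form of harmonicity and real expectations of
    nonnegative functions. *)
Lemma mu_harmonic_posneg f : (exists M, forall x, `|f x| <= M) ->
  mu_harmonic mu f <-> forall x, f x =
    Ex mu (fun g => Num.max (f (g * x)%g) 0) -
    Ex mu (fun g => Num.max (- f (g * x)%g) 0).
Proof.
move=> [M bM]; have mu0 := proj1 prob_mu.
suff E x : (\esum_(g in [set: G]) ((fun g => (mu g * f (g * x)%g)%:E)^\+%E g)
     - \esum_(g in [set: G]) ((fun g => (mu g * f (g * x)%g)%:E)^\-%E g))%E =
   (Ex mu (fun g => Num.max (f (g * x)%g) 0) -
    Ex mu (fun g => Num.max (- f (g * x)%g) 0))%:E.
  split=> H x; first by apply: EFin_inj; rewrite -E; exact: H.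
  by rewrite /= E -H.
have M0 : 0 <= M by apply: le_trans (bM 1%g).
rewrite EFinB !ExE//; last 2 first.
- exists M => g; rewrite le_max lexx orbT ge_max M0 andbT /=.
  by rewrite lerNl; have := bM (g * x)%g; rewrite ler_norml => /andP[].
- exists M => g; rewrite le_max lexx orbT ge_max M0 andbT /=.
  by have := bM (g * x)%g; rewrite ler_norml => /andP[].
congr (_ - _)%E; apply: eq_esum => g _.
  by rewrite funeposE maxr_pMr// mulr0 EFin_max.
by rewrite funenegE maxr_pMr// mulr0 EFin_max mulrN EFinN.
Qed.

Lemma mu_harmonic01 f : (forall x, 0 <= f x <= 1) ->
  (forall x, f x = Ex mu (fun g => f (g * x)%g)) -> mu_harmonic mu f.
Proof.
move=> f01 hf; apply/mu_harmonic_posneg.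
  by exists 1 => x; have /andP[? ?] := f01 x; rewrite ger0_norm.
move=> x; rewrite [LHS]hf -[LHS]subr0; congr (_ - _).
  by apply: eq_Ex => g; apply/esym/max_idPl; have /andP[] := f01 (g * x)%g.
rewrite -[LHS](Ex_cst prob_mu (lexx 0)); apply: eq_Ex => g.
by apply/esym/max_idPr; rewrite oppr_le0; have /andP[] := f01 (g * x)%g.
Qed.

(** c may be negative, so the identity f + c + f^- + |c| = f^+ + c + |c| is
    integrated instead, all of its terms being nonnegative. *)
Lemma mu_harmonic_shift f c : (exists M, forall x, `|f x| <= M) ->
  mu_harmonic mu f -> (forall x, 0 <= f x + c) ->
  forall x, f x + c = Ex mu (fun g => f (g * x)%g + c).
Proof.
move=> bf /(mu_harmonic_posneg bf) hf fc0 x; have [M bM] := bf.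
have fM y : - M <= f y <= M by rewrite -ler_norml.
have M0 : 0 <= M by apply: le_trans (bM 1%g).
pose f1 g := f (g * x)%g + c.
pose fp g := Num.max (f (g * x)%g) 0; pose fn g := Num.max (- f (g * x)%g) 0.
have b1 : nnbounded f1.
  by exists (M + c) => g; rewrite /f1 fc0 lerD2r; have /andP[] := fM (g * x)%g.
have bp : nnbounded fp.
  exists M => g; rewrite /fp le_max lexx orbT ge_max M0 andbT /=.
  by have /andP[] := fM (g * x)%g.
have bn : nnbounded fn.
  exists M => g; rewrite /fn le_max lexx orbT ge_max M0 andbT /=.
  by rewrite lerNl; have /andP[] := fM (g * x)%g.
have cc0 : 0 <= c + `|c| by have := ler_norm (- c); rewrite normrN; lra.
have bc : nnbounded (fun _ : G => `|c|) by exact: nnbounded_cst.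
have bcc : nnbounded (fun _ : G => c + `|c|) by exact: nnbounded_cst.
have : Ex mu f1 + (Ex mu fn + Ex mu (fun=> `|c|)) =
    Ex mu fp + Ex mu (fun=> c + `|c|).
  rewrite -(ExD prob_mu bn bc) -(ExD prob_mu b1 (nnboundedD bn bc)).
  rewrite -(ExD prob_mu bp bcc); apply: eq_Ex => g; rewrite /f1 /fn /fp !maxEle.
  by rewrite oppr_le0; do 2 case: ifP; lra.
by rewrite !Ex_cst//; have := hf x; rewrite -/fp -/fn -/f1; lra.
Qed.

Local Notation p_ := (convolution_power mu).

(** It is enough to show that the difference is small along every ultrafilter
    U containing the tails of nat.
    Shifting the time by j before taking the limit makes u space-time harmonic
    without knowing that consecutive powers are close to each other. *)
Lemma convolution_power_translate_cvg (f : nat -> G -> R) x :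
  aperiodic_walk mu -> trivial_Poisson_boundary mu ->
  (forall n y, 0 <= f n y <= 1) ->
  Ex (p_ n) (fun h => f n (h * x)%g) - Ex (p_ n) (f n) @[n --> \oo] --> 0.
Proof.
move=> ap triv f01; apply/cvgrPdist_lt => eps eps0.
have pn n : prob_measure (p_ n) by exact: prob_convolution_power.
pose d n := Ex (p_ n) (fun h => f n (h * x)%g) - Ex (p_ n) (f n).
apply: contrapT => nB.
pose B := [set n | `|0 - d n| < eps].
have FB : ProperFilter (within (~` B) \oo).
  split; last exact: within_filter.
  by rewrite /within /= => H; apply: nB; apply: filterS H => n /= /contrapT.
have [U [UU subU]] := ultraFilterLemma FB.
have FU : ProperFilter U by exact: ultra_proper.
have ooU : \oo `<=` U.
  by move=> A ooA; apply: subU; exact: (@cvg_within _ \oo _ (~` B)).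
have UnB : U (~` B) by apply: subU; exact: (@withinT _ \oo (~` B) _).
pose H i n y := Ex (p_ i) (fun h => f n (h * y)%g).
have H01 i n y : 0 <= H i n y <= 1 by apply: Ex01.
have HS i n y : H i.+1 n y = Ex mu (fun g => H i n (g * y)%g).
  rewrite /H Ex_powerSr//; last exact/nnbounded01.
  by apply: eq_Ex => g; apply: eq_Ex => h; rewrite mulgA.
have cvgH j y : cvg (H (n - j)%N n y @[n --> U]) by apply: ultra_cvg01.
pose u j y := lim (H (n - j)%N n y @[n --> U]).
have u01 j y : 0 <= u j y <= 1.
  apply/andP; split.
    by apply: limr_ge; [exact: cvgH|apply: nearW => n; have /andP[] := H01 (n - j)%N n y].
  by apply: limr_le; [exact: cvgH|apply: nearW => n; have /andP[] := H01 (n - j)%N n y].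
have hu : space_time_harmonic mu u.
  move=> j y.
  have uS : Ex mu (fun g => H (n - j.+1)%N n (g * y)%g) @[n --> U] -->
      Ex mu (fun g => u j.+1 (g * y)%g).
    by apply: cvg_Ex => // g; exact: cvgH.
  apply: cvg_lim => //; apply: cvg_trans uS; apply: near_eq_cvg.
  apply: ooU; exists j.+1 => // n /= jn.
  by rewrite -HS subnSK.
have harm : mu_harmonic mu (u 0%N).
  apply: mu_harmonic01 => // y; rewrite [LHS]hu; apply: eq_Ex => g.
  by rewrite -(space_time_harmonic_aperiodic prob_mu 0 _ ap u01 hu).
have [k uk] : exists k, forall y, u 0%N y = k.
  apply: triv harm; exists 1 => y.
  by have /andP[? ?] := u01 0%N y; rewrite ger0_norm.
have : d n @[n --> U] --> u 0%N x - u 0%N 1%g.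
  rewrite (_ : d = fun n => H (n - 0)%N n x - H (n - 0)%N n 1%g).
    by apply: cvgB; exact: cvgH.
  apply/funext => n; rewrite /d /H subn0; congr (_ - _).
  by apply: eq_Ex => h; rewrite mulg1.
rewrite !uk subrr => /cvgrPdist_lt/(_ _ eps0) UB.
by have [n [Bn]] := filter_ex (filterI UB UnB); apply.
Qed.

End Limits.


(** * Finiteness of balls *)

Section Words.
Variables (G : groupType) (S : set G).

Lemma word_length1 : word_length S 1%g = 0%N.
Proof.
rewrite /word_length; case: pselect => // ex.
case: ex_minnP => m _ /(_ 0%N); rewrite leqn0 => H; apply/eqP/H/asboolP.
by exists [::]; split=> //; rewrite big_nil.
Qed.

Lemma word_length_is_word g : generates_group S ->
  is_word (sym_set S) g (word_length S g).
Proof.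
move=> genS; rewrite /word_length; case: pselect => [ex|nex]; last first.
  by exfalso; apply: nex; have [n gn] := genS g; exists n; exact/asboolP.
by case: ex_minnP => m /asboolP.
Qed.

Lemma finite_words (A : set G) n : finite_set A -> finite_set [set g | is_word A g n].
Proof.
move=> finA; elim: n => [|n IHn].
  apply: (@sub_finite_set _ _ [set 1%g]) => [g [w [/size0nil -> _ ->]]|].
    by rewrite big_nil.
  exact: finite_set1.
apply: (@sub_finite_set _ _ ((fun gh => gh.1 * gh.2)%g @`
    (A `*` [set g | is_word A g n]))); last first.
  by apply: finite_image; exact: finite_setX.
move=> g [[|x w] [//= [sw] Aw ->]]; exists (x, \prod_(y <- w) y)%g => /=.
  split; first by apply: Aw; rewrite inE eqxx.
  by exists w; split=> // y yw; apply: Aw; rewrite inE yw orbT.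
by rewrite big_cons.
Qed.

Lemma finite_ball n : finite_set S -> generates_group S ->
  finite_set [set g | (word_length S g <= n)%N].
Proof.
move=> finS genS; have finA : finite_set (sym_set S).
  apply: (@sub_finite_set _ _ (S `|` (fun x => x^-1)%g @` S)).
    move=> x [Sx|Sx]; [by left|right]; exists (x^-1)%g => //; exact: invgK.
  by rewrite finite_setU; split=> //; exact: finite_image.
apply: (@sub_finite_set _ _
    (\bigcup_(m in `I_n.+1) [set g | is_word (sym_set S) g m])).
  by move=> g gn; exists (word_length S g) => //; exact: word_length_is_word.
by apply: bigcup_finite => [|m _]; [exact: finite_II|exact: finite_words].
Qed.

End Words.

(** * Diagonal choices *)

Lemma last_below (P : nat -> Prop) n : exists m,
  (P 0%N -> P m) /\ forall k, (k <= n)%N -> P k -> (k <= m)%N.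
Proof.
elim: n => [|n [m [P0m mP]]]; first by exists 0%N.
have [Pn|nPn] := pselect (P n.+1); first by exists n.+1.
exists m; split=> // k; rewrite leq_eqVlt => /predU1P[->//|]; exact: mP.
Qed.

(** Take for r n the last k <= n whose threshold has been passed at time n. *)
Lemma diagonal_near (Q : nat -> nat -> Prop) :
  (forall k, \forall n \near \oo, Q k n) ->
  exists r : nat -> nat, (forall k, \forall n \near \oo, (k <= r n)%N) /\
    \forall n \near \oo, Q (r n) n.
Proof.
move=> QF; have /choice[N NQ] : forall k, exists N, forall n, (N <= n)%N -> Q k n.
  by move=> k; have [N _ NQ] := QF k; exists N => n; exact: NQ.
have /choice[r rP] := fun n => last_below (fun k => N k <= n)%N n.
exists r; split=> [k|].
  exists (maxn k (N k)) => // n /=; rewrite geq_max => /andP[kn Nkn].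
  by apply: (proj2 (rP n)).
by exists (N 0%N) => // n N0n; apply: NQ; exact: (proj1 (rP n)).
Qed.

(** * The implications *)

Section Implications.
Variables (R : realType) (G : groupType) (S : set G) (mu : G -> R).
Hypothesis prob_mu : prob_measure mu.
Local Notation p_ := (convolution_power mu).

Let prob_power n : prob_measure (p_ n).
Proof. exact: prob_convolution_power. Qed.
Local Hint Resolve prob_power : core.

Lemma almost_invariant_weakly_individually r :
  almost_invariant mu S r -> weakly_individually_almost_invariant mu S r.
Proof.
move=> ai g gr; have h0 : 0 < 1 / 2 :> R by lra.
exists (1 / 4), (1 / 2), (3 / 2), (fun n => [set h | 0 < p_ n h /\
  `|p_ n (h * g n)%g / p_ n h - 1| <= 1 / 2]); split; [lra|lra|lra|].
apply: filterS (ai _ h0) => n [V [massV Vn]]; split; last first.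
  by move=> h [_]; rewrite ler_distl => /andP[? ?] _; apply/andP; split; lra.
apply: (@lt_le_trans _ _ (1 - 1 / 2)%:E); first by rewrite lte_fin; lra.
apply: le_trans massV _; rewrite !total_massE// lee_fin.
apply: Ex_le => //; [exact: nnbounded_indic|exact: nnbounded_indic|move=> h _].
rewrite !indicE; have [/set_mem Vh|_] := boolP (h \in V); last by rewrite ler0n.
by rewrite mem_set//; exact: Vn.
Qed.

(** The affine change of values taking inf f to 0 and sup f to 1 preserves
    harmonicity. *)
Lemma normalized_harmonic f : (exists M, forall x, `|f x| <= M) ->
  mu_harmonic mu f -> ~ (exists k, forall x, f x = k) ->
  exists F : G -> R, [/\ forall x, 0 <= F x <= 1,
    forall x, F x = Ex mu (fun g => F (g * x)%g) &
    forall eps, 0 < eps -> exists x y, F x > 1 - eps /\ F y < eps].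
Proof.
move=> bf hf nk; have [M bM] := bf.
have fM y : - M <= f y <= M by rewrite -ler_norml.
have suf : has_sup (range f).
  split; first by exists (f 1%g), 1%g.
  by exists M => _ [y _ <-]; have /andP[] := fM y.
have inff : has_inf (range f).
  split; first by exists (f 1%g), 1%g.
  by exists (- M) => _ [y _ <-]; have /andP[] := fM y.
pose a := inf (range f); pose b := sup (range f).
have af y : a <= f y by apply: ge_inf; [case: inff|exists y].
have fb y : f y <= b by apply: ub_le_sup; [case: suf|exists y].
have ab : 0 < b - a.
  rewrite subr_gt0 ltNge; apply/negP => ba; apply: nk; exists a => y.
  by apply/eqP; rewrite eq_le af andbT; apply: le_trans (fb y) ba.
have i0 : 0 < (b - a)^-1 by rewrite invr_gt0.
exists (fun y => (b - a)^-1 * (f y - a)); split=> [x|x|eps e0].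
- rewrite mulr_ge0 ?(ltW i0) ?subr_ge0//= mulrC ler_pdivrMr// mul1r.
  by rewrite lerB.
- have fa0 y : 0 <= f y - a by rewrite subr_ge0.
  rewrite ExZ//; last 2 first.
  + exact: ltW.
  + by exists (b - a) => g; rewrite fa0 lerB.
  by rewrite -(mu_harmonic_shift prob_mu bf hf fa0).
- have eba : 0 < eps * (b - a) by rewrite mulr_gt0.
  have [_ [x _ <-] bx] := sup_adherent eba suf.
  have [_ [y _ <-] ay] := inf_adherent eba inff.
  exists x, y; split; rewrite mulrC.
    by rewrite ltr_pdivlMr//; rewrite -/b in bx; lra.
  by rewrite ltr_pdivrMr//; rewrite -/a in ay; lra.
Qed.

(** The elements z k separate F almost completely, and z1 (m n) is the last of
    them that fits into the ball of radius r n, so it has arbitrarily large index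
    along phi. Putting the identity first in z1 makes some element always fit. *)
Lemma weakly_invariant_trivial (r : nat -> R) (phi : nat -> nat) :
  (forall n, 0 <= r n) -> {homo phi : m n / (m < n)%N} ->
  r (phi n) @[n --> \oo] --> +oo ->
  weakly_individually_almost_invariant mu S r -> trivial_Poisson_boundary mu.
Proof.
move=> r0 phi_mono rphi wi f bf hf; apply: contrapT => nk.
have [F [F01 hF Fext]] := normalized_harmonic bf hf nk.
have /choice[z zP] : forall k : nat, exists z : G,
    exists x, F x > 1 - k.+1%:R^-1 /\ F (z^-1 * x)%g < k.+1%:R^-1.
  move=> k; have [|x [y [Fx Fy]]] := Fext k.+1%:R^-1; first by rewrite invr_gt0.
  by exists (x * y^-1)%g, x; rewrite invgM invgK mulgVK.
pose z1 k := if k is k'.+1 then z k' else 1%g.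
have /choice[m mP] := fun n => last_below (fun k => (word_length S (z1 k))%:R <= r n) n.
have [|a [c [C [V [a0 c0 _ VP]]]]] := wi (fun n => z1 (m n)).
  by move=> n; apply: (proj1 (mP n)); rewrite /z1 word_length1.
have ca0 : 0 < c * a / (1 + c) by rewrite divr_gt0 ?mulr_gt0// addr_gt0.
have [k kP] : exists k : nat, k.+1%:R^-1 < c * a / (1 + c).
  exists (Num.bound (c * a / (1 + c))^-1); rewrite invf_plt ?posrE//.
  apply: lt_trans (archi_boundP _) _; first by rewrite invr_ge0 ltW.
  by rewrite ltr_nat.
have phi_ge n : (n <= phi n)%N.
  by elim: n => // n IHn; exact: leq_ltn_trans IHn (phi_mono _ _ (ltnSn n)).
have [N _ NP] := VP.
have /cvgryPge/(_ (word_length S (z k))%:R)[N' _ N'P] := rphi.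
pose M := maxn N (maxn N' k.+1); pose n := phi M.
have nM : (M <= n)%N by exact: phi_ge.
have [massV ratio] : (a%:E < total_mass (p_ n) (V n))%E /\
    forall h, V n h -> 0 < p_ n h -> c <= p_ n (h * z1 (m n))%g / p_ n h <= C.
  by apply: NP => /=; apply: leq_trans nM; rewrite leq_maxl.
have km : (k.+1 <= m n)%N.
  apply: (proj2 (mP n)); first by apply: leq_trans nM; rewrite /M !leq_max leqnn !orbT.
  by apply: N'P; rewrite /= /M !leq_max leqnn orbT.
case: (m n) km ratio => // k' kk' /= ratio.
have [x [Fx Fzx]] := zP k'; set g := z k' in Fzx ratio.
have dk : k'.+1%:R^-1 <= k.+1%:R^-1 :> R by rewrite lef_pV2 ?posrE// ler_nat.
have Fpow y : F y = Ex (p_ n) (fun h => F (h * y)%g).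
  exact: (@space_time_harmonic_power _ _ _ prob_mu (fun=> F) n 0).
have bFx : forall h, 0 <= F (h * x)%g <= 1 by move=> h; exact: F01.
have bVF : nnbounded (fun h => \1_(V n) h * F (h * x)%g).
  apply: nnbounded01 => h; have := indic01 R (V n) h; have := bFx h.
  by rewrite indicE; case: (h \in V n); rewrite ?mul1r ?mul0r ?lexx ?ler01.
(* Reindexing by g turns the expectation giving F (g^-1 * x) into one of the
   same function h |-> F (h * x) under the translated measure. *)
have le_translate : c * Ex (p_ n) (fun h => \1_(V n) h * F (h * x)%g) <=
    F (g^-1 * x)%g.
  have -> : F (g^-1 * x)%g = Ex (fun h => p_ n (h * g)%g) (fun h => F (h * x)%g).
    rewrite Fpow -{2}[g]invgK -Ex_shift.
    by apply: eq_Ex => h; rewrite mulgA.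
  have pg := prob_shift (prob_power n) g.
  apply: (@le_trans _ _ (1 * Ex (fun h => p_ n (h * g)%g)
      (fun h => \1_(V n) h * F (h * x)%g))).
    apply: Ex_le_weight => //; first exact: ltW.
    move=> h; rewrite indicE mul1r; have [/set_mem Vh _|] := boolP (h \in V n);
      last first.
      by rewrite mul0r eqxx.
    have := proj1 (prob_power n) h; rewrite le_eqVlt => /predU1P[<-|ph].
      by rewrite mulr0; exact: (proj1 pg).
    by rewrite -ler_pdivlMr//; have /andP[] := ratio h Vh ph.
  rewrite mul1r; apply: Ex_le => //; first exact: nnbounded01.
  move=> h _; have /andP[Fh _] := bFx h.
  by rewrite indicE; case: (h \in V n); rewrite ?mul1r ?mul0r.
(* F (h * x) has mean F x, close to its maximum, so restricting to V n loses
   little. *)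
have massVF : a <= Ex (p_ n) (fun h => \1_(V n) h * F (h * x)%g) + (1 - F x).
  rewrite [F x]Fpow -Ex_compl// -ExD//; last first.
    by apply: nnbounded01 => h; have := bFx h; lra.
  apply: (@le_trans _ _ (Ex (p_ n) \1_(V n))).
    by apply: ltW; rewrite -lte_fin -total_massE.
  apply: Ex_le => //; first exact: nnbounded_indic.
    by apply: nnboundedD => //; apply: nnbounded01 => h; have := bFx h; lra.
  move=> h _; rewrite indicE; have := bFx h.
  by case: (h \in V n); rewrite ?mul1r ?mul0r /=; lra.
move: kP; rewrite ltr_pdivlMr ?addr_gt0// => kP.
move: massVF le_translate; set E := Ex _ _ => massVF le_translate.
have : c * a <= c * (E + (1 - F x)) by rewrite ler_pM2l.
have : c * (1 - F x) <= c * k.+1%:R^-1 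
  by rewrite ler_pM2l//; apply: le_trans dk; rewrite lerBlDr -lerBlDl ltW.
have := lt_le_trans Fzx dk; move: kP; set d := k.+1%:R^-1.
lra.
Qed.

Definition good_ratio n (eps : R) (g : G) := [set h | 0 < p_ n h /\
  `|p_ n (h * g)%g / p_ n h - 1| <= eps].

(** On the set where p_n(hg) exceeds (1 + eps) p_n(h), the translated measure
    has at least eps times more mass than p_n, and symmetrically where it is
    below (1 - eps) p_n(h); the indicators of these sets are test functions for
    which the two masses become close. *)
Lemma good_ratio_near eps delta g :
  aperiodic_walk mu -> trivial_Poisson_boundary mu ->
  0 < eps <= 1 -> 0 < delta ->
  \forall n \near \oo, Ex (p_ n) \1_(~` good_ratio n eps g) <= delta.
Proof.
move=> ap triv /andP[e0 e1] d0.
pose Ap n := [set h | (1 + eps) * p_ n h < p_ n (h * g)%g].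
pose Am n := [set h | p_ n (h * g)%g < (1 - eps) * p_ n h].
have ed : 0 < eps * (delta / 2) by rewrite mulr_gt0 ?divr_gt0.
have cvgA A : \forall n \near \oo,
    `|Ex (fun h => p_ n (h * g)%g) \1_(A n) - Ex (p_ n) \1_(A n)| < eps * (delta / 2).
  have A01 n y : 0 <= (\1_(A n) y : R) <= 1 by exact: indic01.
  have := convolution_power_translate_cvg prob_mu g^-1 ap triv A01.
  move=> /cvgrPdist_lt/(_ _ ed); apply: filterS => n.
  by rewrite sub0r normrN (Ex_shift (p_ n) \1_(A n)) invgK.
apply: filterS2 (cvgA Ap) (cvgA Am) => n; rewrite !ltr_norml => /andP[_ dp] /andP[dm _].
have pg := prob_shift (prob_power n) g.
have bA A : nnbounded (\1_A : G -> R) by exact: nnbounded_indic.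
have Ap_le : (1 + eps) * Ex (p_ n) \1_(Ap n) <=
    1 * Ex (fun h => p_ n (h * g)%g) \1_(Ap n).
  apply: Ex_le_weight => //; first by lra.
  move=> h; rewrite indicE mul1r; have [/set_mem/ltW//|] := boolP (h \in Ap n).
  by rewrite eqxx.
have Am_le : 1 * Ex (fun h => p_ n (h * g)%g) \1_(Am n) <=
    (1 - eps) * Ex (p_ n) \1_(Am n).
  apply: Ex_le_weight => //; first by lra.
  move=> h; rewrite indicE mul1r; have [/set_mem/ltW//|] := boolP (h \in Am n).
  by rewrite eqxx.
have Ap_small : Ex (p_ n) \1_(Ap n) <= delta / 2 by rewrite -(ler_pM2l e0); lra.
have Am_small : Ex (p_ n) \1_(Am n) <= delta / 2 by rewrite -(ler_pM2l e0); lra.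
apply: (@le_trans _ _ (Ex (p_ n) (fun h => \1_(Ap n) h + \1_(Am n) h))); last first.
  by rewrite ExD//; lra.
apply: Ex_le => //; first exact: nnboundedD.
move=> h ph; have /andP[Ap0 _] := indic01 R (Ap n) h.
have /andP[Am0 _] := indic01 R (Am n) h.
rewrite [leLHS]indicE; have [/set_mem bad|_] := boolP (h \in _); last by rewrite addr_ge0.
have [hp|hp] := ltP ((1 + eps) * p_ n h) (p_ n (h * g)%g).
  by rewrite [\1_(Ap n) h]indicE mem_set//= lerDl.
have [hm|hm] := ltP (p_ n (h * g)%g) ((1 - eps) * p_ n h).
  by rewrite [\1_(Am n) h]indicE mem_set//= lerDr.
case: bad; split=> //; rewrite ler_distl.
by rewrite ler_pdivlMr// ler_pdivrMr// hm hp.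
Qed.

Lemma good_ratios_near eps delta (A : set G) :
  aperiodic_walk mu -> trivial_Poisson_boundary mu ->
  0 < eps <= 1 -> 0 < delta -> finite_set A ->
  \forall n \near \oo,
    Ex (p_ n) \1_(~` [set h | forall g, A g -> good_ratio n eps g h]) <= delta.
Proof.
move=> ap triv e01 + /finite_seqP[s ->].
elim: s delta => [|g s IHs] delta d0.
  apply: nearW => n; apply: le_trans (ltW d0).
  rewrite -[leRHS](Ex_cst (prob_power n) (lexx 0)) (@eq_Ex _ _ _ _ (fun=> 0))// => h.
  by rewrite indicE memNset//; apply=> g; rewrite /= in_nil.
have d2 : 0 < delta / 2 by rewrite divr_gt0.
apply: filterS2 (good_ratio_near g ap triv e01 d2) (IHs _ d2) => n.
set B1 := ~` _; set B2 := ~` _ => le1 le2.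
have bA A' : nnbounded (\1_A' : G -> R) by exact: nnbounded_indic.
apply: (@le_trans _ _ (Ex (p_ n) (fun h => \1_B1 h + \1_B2 h))); last first.
  by rewrite ExD//; lra.
apply: Ex_le => //; first exact: nnboundedD.
move=> h _; have /andP[B10 _] := indic01 R B1 h.
have /andP[B20 _] := indic01 R B2 h.
rewrite [leLHS]indicE; have [/set_mem bad|_] := boolP (h \in _); last by rewrite addr_ge0.
have [h1|h1] := pselect (B1 h); first by rewrite [\1_B1 h]indicE mem_set//= lerDl.
rewrite [\1_B2 h]indicE mem_set//= ?lerDr// => h2; apply: bad => k /=.
by rewrite inE => /orP[/eqP ->|ks]; [exact: contrapT h1|exact: h2].
Qed.

Lemma trivial_almost_invariant : finite_set S -> generates_group S ->
  aperiodic_walk mu -> trivial_Poisson_boundary mu ->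
  exists r : nat -> R, [/\ forall n, 0 <= r n, r n @[n --> \oo] --> +oo &
    almost_invariant mu S r].
Proof.
move=> finS genS ap triv.
pose V k n := [set h | forall g, [set g | (word_length S g <= k)%N] g ->
  good_ratio n k.+1%:R^-1 g h].
pose Q k n := Ex (p_ n) \1_(~` V k n) <= k.+1%:R^-1.
have inv01 (k : nat) : 0 < (k.+1%:R^-1 : R) <= 1.
  by rewrite invr_gt0 ltr0n invf_le1 ?ler1n ?ltr0n.
have /diagonal_near[r [rinfty rQ]] : forall k, \forall n \near \oo, Q k n.
  by move=> k; apply: good_ratios_near => //; exact: finite_ball.
exists (fun n => (r n)%:R); split=> [n||eps e0]; first exact: ler0n.
  apply/cvgryPge => A.
  apply: filterS (rinfty (Num.bound `|A|)) => n rn.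
  apply: le_trans (ler_norm A) _; apply: le_trans (ltW (archi_boundP _)) _ => //.
  by rewrite ler_nat.
apply: filterS2 rQ (rinfty (Num.bound eps^-1)) => n Qn rn.
have re : (r n).+1%:R^-1 <= eps.
  rewrite -[eps]invrK lef_pV2 ?posrE ?invr_gt0//.
  apply: le_trans (ltW (archi_boundP _)) _; first by rewrite invr_ge0 ltW.
  by rewrite ler_nat; exact: leqW.
exists (V (r n) n); split=> [|h g Vh].
  rewrite total_massE// lee_fin; move: Qn; rewrite /Q.
  have -> : \1_(~` V (r n) n) = (fun x => 1 - \1_(V (r n) n) x) :> (G -> R).
    by apply/funext => x; rewrite !indicE in_setC; case: (x \in _) => /=; lra.
  rewrite Ex_compl//; last exact: indic01.
  by move=> /le_trans/(_ re); lra.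
rewrite ler_nat => gr; have [ph hg] := Vh g gr; split=> //.
exact: le_trans hg re.
Qed.

End Implications.

Theorem proposition2p6 (R : realType) (G : groupType) (S : set G) (mu : G -> R)
    (finS : finite_set S) (genS : generates_group S)
    (prob_mu : prob_measure mu) (nd_mu : nondegenerate_walk mu)
    (ap_mu : aperiodic_walk mu) :
  [<->
    exists r : nat -> R,
      [/\ forall n, 0 <= r n,
          r n @[n --> \oo] --> +oo &
          almost_invariant mu S r];
    exists r : nat -> R,
      [/\ forall n, 0 <= r n,
          exists2 phi : nat -> nat,
            {homo phi : m n / (m < n)%N} & r (phi n) @[n --> \oo] --> +oo &
          weakly_individually_almost_invariant mu S r];
    trivial_Poisson_boundary mu].
Proof.
tfae.
- move=> [r [r0 rinfty air]]; exists r; split=> //; first by exists id.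
  exact: almost_invariant_weakly_individually.
- move=> [r [r0 [phi phi_mono rphi] weak]].
  exact: (weakly_invariant_trivial prob_mu r0 phi_mono rphi weak).
- exact: trivial_almost_invariant.
Qed.
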